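(* Let $p\in[1,\infty)$. The space $\Lambda_p(\mathbb{R}^d)$, with the topology induced by the metric $(f,g)\mapsto\|f-g\|_{\alpha_p}$, is separable.
   Context: $\mathbb{R}^d$ is endowed with the Borel $\sigma$-algebra and the Lebesgue measure, denoted $|\cdot|$. $\Lambda_p(\mathbb{R}^d)$ is the set of real-valued measurable functions $f$ on $\mathbb{R}^d$ (identified a.e.) such that for every $\delta>0$ there exists a measurable set $E_\delta$ with $|E_\delta|<\delta$ and $f\chi_{E_\delta^c}\in L_p(\mathbb{R}^d)$. For a measurable function $f$, $\|f\|_{\alpha_p}=\|\min(|f|,1)\|_p$, where $\|\cdot\|_p$ is the $L_p$ norm. *)

(* Defs.v *)
From HB Require Import structures.
From mathcomp Require Import all_boot all_order all_algebra.
From mathcomp Require Import all_classical all_reals all_analysis.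
From mathcomp Require Import measurable_realfun.
From mathcomp Require Import lra.
Set Implicit Arguments.
Unset Strict Implicit.
Unset Printing Implicit Defensive.
Import Order.TTheory GRing.Theory Num.Theory.
Import numFieldNormedType.Exports.
Local Open Scope classical_set_scope.
Local Open Scope ring_scope.

(* R^d as d-tuples of reals, with the sigma-algebra that the library puts on
   tuples (the one generated by the coordinates).  Lemma measurable_tupleE below
   shows that it is the Borel sigma-algebra. *)
Notation euclid R d := (d.-tuple (measurableTypeR R)).

Section lebesgue_tuple.
Variable R : realType.

Definition cons_pair d (xt : measurableTypeR R * euclid R d) : euclid R d.+1 :=
  [tuple of xt.1 :: xt.2].

Lemma measurable_cons_pair d : measurable_fun setT (@cons_pair d).
Proof. exact: measurable_cons. Qed.

Definition uncons_pair d (t : euclid R d.+1) : measurableTypeR R * euclid R d :=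
  (thead t, [tuple of behead t]).

Lemma measurable_uncons_pair d : measurable_fun setT (@uncons_pair d).
Proof.
apply/measurable_fun_pairP; split; first exact: measurable_tnth.
exact: measurable_behead.
Qed.

Lemma cons_pairK d : cancel (@cons_pair d) (@uncons_pair d).
Proof.
move=> [x t]; rewrite /cons_pair /uncons_pair /=; congr pair.
exact/val_inj.
Qed.

Section cons_measure.
Variables (d : nat) (m : {sigma_finite_measure set (euclid R d) -> \bar R}).

Definition cons_measure : set (euclid R d.+1) -> \bar R :=
  pushforward (@lebesgue_measure R \x m)%E (@cons_pair d).

Let measurable_preimage_cons A :
  measurable A -> measurable (@cons_pair d @^-1` A).
Proof.
by move=> mA; rewrite -[X in measurable X]setTI; exact: measurable_cons_pair.
Qed.

Let cons_measure0 : cons_measure set0 = 0%E.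
Proof. by rewrite /cons_measure /pushforward preimage_set0 measure0. Qed.

Let cons_measure_ge0 A : (0 <= cons_measure A)%E.
Proof. by rewrite /cons_measure /pushforward measure_ge0. Qed.

Let cons_measure_sigma_additive : semi_sigma_additive cons_measure.
Proof.
move=> F mF tF mUF; rewrite /cons_measure /pushforward preimage_bigcup.
apply: measure_semi_sigma_additive.
- by move=> n; exact: measurable_preimage_cons.
- apply/trivIsetP => /= i j _ _ ij; rewrite -preimage_setI.
  by move/trivIsetP : tF => /(_ _ _ _ _ ij) ->//; rewrite preimage_set0.
- by rewrite -preimage_bigcup; exact: measurable_preimage_cons.
Qed.

HB.instance Definition _ := isMeasure.Build _ _ _ cons_measure
  cons_measure0 cons_measure_ge0 cons_measure_sigma_additive.

Let sigma_finite_cons : sigma_finite setT cons_measure.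
Proof.
have /sigma_finiteP[F [TF ndF Foo]] := sigma_finiteT (@lebesgue_measure R).
have /sigma_finiteP[G [TG ndG Goo]] := sigma_finiteT m.
exists (fun n => @uncons_pair d @^-1` (F n `*` G n)).
  rewrite -preimage_bigcup (_ : \bigcup_i _ = setT) ?preimage_setT //.
  apply/seteqP; split => // -[x t] _.
  have [k _ Fx] : (\bigcup_i F i) x by rewrite -TF.
  have [l _ Gt] : (\bigcup_i G i) t by rewrite -TG.
  exists (maxn k l) => //; split.
  - by move: x Fx; exact/subsetPset/ndF/leq_maxl.
  - by move: t Gt; exact/subsetPset/ndG/leq_maxr.
move=> k; have [mF ?] := Foo k; have [mG ?] := Goo k; split.
  rewrite -[X in measurable X]setTI; apply: measurable_uncons_pair => //.
  exact: measurableX.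
rewrite /cons_measure /pushforward -comp_preimage (_ : _ \o _ = id); last first.
  by apply/funext => x; exact: cons_pairK.
by rewrite preimage_id product_measure1E // lte_mul_pinfty // ge0_fin_numE.
Qed.

HB.instance Definition _ :=
  Measure_isSigmaFinite.Build _ _ _ cons_measure sigma_finite_cons.
End cons_measure.

(* Lebesgue measure on R^d, as the d-fold product of lebesgue_measure:
   R^(d+1) is identified with R * R^d by consing.  For d = 0 this is the unit
   mass at the empty tuple. *)
Fixpoint lebesgue_tuple d : {sigma_finite_measure set (euclid R d) -> \bar R} :=
  match d with
  | 0 => \d_([tuple] : euclid R 0)
  | d'.+1 => cons_measure (lebesgue_tuple d')
  end.

Lemma lebesgue_tuple_box d (A : 'I_d -> set (measurableTypeR R)) :
  (forall i, measurable (A i)) ->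
  lebesgue_tuple d [set t | forall i, A i (tnth t i)] =
  (\prod_(i < d) lebesgue_measure (A i))%E.
Proof.
elim: d => [|d IH] in A * => mA /=.
  by rewrite big_ord0 diracE mem_set // => -[].
rewrite /cons_measure /pushforward big_ord_recl -IH; last by move=> i; exact: mA.
rewrite -product_measure1E //; last first.
  rewrite (_ : mkset _ = \bigcap_(i in [set: 'I_d])
      ((fun t : euclid R d => tnth t i) @^-1` A (lift ord0 i))); last first.
    by apply/seteqP; split => t /= h i; [move=> _|]; exact: h.
  apply: fin_bigcap_measurable; first exact: finite_finset.
  by move=> i _; rewrite -[X in measurable X]setTI; exact: measurable_tnth.
congr (_ _); apply/seteqP; split => -[x t] /=.
  move=> h; split; first exact: (h ord0).
  by move=> i; have := h (lift ord0 i); rewrite tnthS.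
move=> [hx ht] i; case: (unliftP ord0 i) => [j ->|->//].
by rewrite tnthS.
Qed.

(* The open sets are those of 'rV[R]_d, transported to d-tuples. *)
Lemma measurable_tupleE d : @measurable _ (euclid R d) =
  <<s [set A | open [set v : 'rV[R]_d | A [tuple v ord0 i | i < d]]] >>.
Proof.
apply/seteqP; split.
  apply: smallest_sub; first exact: smallest_sigma_algebra.
  move=> A; rewrite -bigcup_seq /= => -[i _ [B mB <-]].
  have -> : [set: euclid R d] `&` (fun t : euclid R d => tnth t i) @^-1` B =
      (fun t : euclid R d => tnth t i) @^-1` B by rewrite setTI.
  move: mB; rewrite (RGenOInfty.measurableE R).
  set G := <<s [set A | open _] >>.
  suff : <<s @RGenOInfty.G R >> `<=`
      [set B | G ((fun t : euclid R d => tnth t i) @^-1` B)] by exact.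
  apply: smallest_sub.
    split => [|C GC|F GF] /=.
    - by rewrite preimage_set0; exact: sigma_algebra0.
    - by rewrite setTD; exact: sigma_algebraC.
    - by rewrite preimage_bigcup; exact: sigma_algebra_bigcup.
  move=> _ [x ->]; apply: sub_sigma_algebra => /=.
  rewrite (_ : mkset _ = (fun v : 'rV[R]_d => v ord0 i) @^-1` `]x, +oo[%classic).
    apply: open_comp => //; first by move=> v _; exact: coord_continuous.
  by apply/seteqP; split => v /=; rewrite tnth_mktuple.
apply: smallest_sub; first exact: sigma_algebra_measurable.
move=> A /= oA.
pose box (qk : d.-tuple rat * nat) :=
  [set t : euclid R d | forall i, `|ratr (tnth qk.1 i) - tnth t i| < qk.2.+1%:R^-1].
rewrite (_ : A = \bigcup_(qk in [set qk | box qk `<=` A]) box qk).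
  rewrite bigcup_mkcond; apply: countable_bigcupT_measurable => //.
  move=> [q k]; case: ifP => // _.
  rewrite (_ : box _ = \bigcap_(i in [set: 'I_d])
     ((fun t : euclid R d => tnth t i) @^-1` ball (ratr (tnth q i) : R) k.+1%:R^-1)).
    apply: fin_bigcap_measurable; first exact: finite_finset.
    move=> i _; rewrite -[X in measurable X]setTI; apply: measurable_tnth => //.
    exact: measurable_ball.
  by apply/seteqP; split => t /= h i; [move=> _|]; exact: h.
apply/seteqP; split => [t At|t [[q k] /= bA bt]]; last exact: bA.
pose v : 'rV[R]_d := \row_i tnth t i.
have tE (w : 'rV[R]_d) (i : 'I_d) : tnth [tuple w ord0 i | i < d] i = w ord0 i.
  by rewrite tnth_mktuple.
have vt : [tuple v ord0 i | i < d] = t.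
  by apply: eq_from_tnth => i; rewrite tE mxE.
have : nbhs v [set v : 'rV[R]_d | A [tuple v ord0 i | i < d]].
  by apply: open_nbhs_nbhs; split => //=; rewrite vt.
move=> /nbhs_ballP [e /= e0 veA].
have e20 : 0 < e / 2 by rewrite divr_gt0.
have [k ke] : exists k : nat, k.+1%:R^-1 < e / 2.
  have [k _ /(_ k (leqnn _)) h] := near_infty_natSinv_lt (PosNum e20).
  by exists k.
have qP (i : 'I_d) : exists q : rat, `|ratr q - tnth t i| < k.+1%:R^-1.
  have k0 : (0 : R) < k.+1%:R^-1 by rewrite invr_gt0.
  have /rat_in_itvoo [q] : tnth t i - k.+1%:R^-1 < tnth t i + k.+1%:R^-1.
    by rewrite ltrBlDr -addrA ltrDl addr_gt0.
  rewrite in_itv /= => /andP[q1 q2]; exists q.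
  by rewrite ltr_norml ltrBrDr addrC q1 ltrBlDl.
have [q hq] := choice qP.
exists ([tuple q i | i < d], k); last by move=> i /=; rewrite tnth_mktuple.
move=> s /= bs; pose w : 'rV[R]_d := \row_i tnth s i.
have ws : [tuple w ord0 i | i < d] = s.
  by apply: eq_from_tnth => i; rewrite tE mxE.
rewrite -ws; apply: veA; split => // i j; rewrite ord1 /ball /= !mxE.
have := bs j; rewrite /= tnth_mktuple => bj.
rewrite (splitr e) -[X in `|X|](subrKA (ratr (q j))).
rewrite (le_lt_trans (ler_normD _ _)) // ltrD //; last exact: lt_trans ke.
by rewrite distrC; exact: lt_trans ke.
Qed.

End lebesgue_tuple.

Section Lambda.
Context d (T : measurableType d) (R : realType).
Variable mu : {measure set T -> \bar R}.
Implicit Types (p : R) (f g h : T -> R).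

Definition alpha_norm p f : \bar R :=
  ('N[mu]_p%:E[EFin \o (fun x => Num.min `|f x| 1)%R])%E.

Definition in_Lambda p f : Prop :=
  forall delta : R, 0 < delta ->
  exists E : set T, [/\ measurable E, (mu E < delta%:E)%E
                      & f \* \1_(~` E) \in Lfun mu p%:E].

(* Elements are classes of measurable functions modulo almost everywhere
   equality; in_Lambda is tested on the chosen representative, and
   ae_eq_in_Lambda below shows that the choice is irrelevant.  The proof p1 is a
   parameter because the metric on this type needs it. *)
Definition LambdaType p (p1 : 1 <= p) : Type :=
  {f : {mfun_ mu, T >-> measurableTypeR R} | `[< in_Lambda p f >]}.

Lemma measurable_min1 f : measurable_fun setT f ->
  measurable_fun setT (fun x => Num.min `|f x| 1).
Proof.
move=> mf; apply: measurable_minr; last exact: measurable_cst.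
exact: measurableT_comp.
Qed.

Lemma measurable_powR_norm p f : measurable_fun setT f ->
  measurable_fun setT (fun x => (`|f x| `^ p)%:E).
Proof.
move=> mf; apply/measurable_EFinP.
apply: (@measurableT_comp _ _ _ _ _ _ (@powR R ^~ p)) => //.
exact: measurableT_comp.
Qed.

Lemma le_Lnorm p f g : 0 < p -> measurable_fun setT f -> measurable_fun setT g ->
  (forall x, `|f x| <= `|g x|) ->
  ('N[mu]_p%:E[EFin \o f] <= 'N[mu]_p%:E[EFin \o g])%E.
Proof.
move=> p0 mf mg fg; rewrite unlock /=.
rewrite gt0_ler_poweR ?invr_ge0 ?(ltW p0) //.
- by rewrite in_itv /= leey andbT integral_ge0 // => x _; rewrite poweR_ge0.
- by rewrite in_itv /= leey andbT integral_ge0 // => x _; rewrite poweR_ge0.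
- apply: ge0_le_integral => //=.
  + exact: measurable_powR_norm.
  + exact: measurable_powR_norm.
  + by move=> x _; rewrite lee_fin ge0_ler_powR ?nnegrE ?(ltW p0).
Qed.

Lemma ae_eq_Lnorm p f g : measurable_fun setT f -> measurable_fun setT g ->
  f = g %[ae mu] ->
  ('N[mu]_p%:E[EFin \o f] = 'N[mu]_p%:E[EFin \o g])%E.
Proof.
move=> mf mg fg; rewrite unlock /=; congr (_ `^ _)%E.
apply: ge0_ae_eq_integral => //=.
- exact: measurable_powR_norm.
- exact: measurable_powR_norm.
- by apply: filterS fg => x /= /(_ I) -> _.
Qed.

Lemma ae_eq_alpha_norm p f g : measurable_fun setT f -> measurable_fun setT g ->
  f = g %[ae mu] -> alpha_norm p f = alpha_norm p g.
Proof.
move=> mf mg fg; apply: ae_eq_Lnorm; [exact: measurable_min1..|].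
by apply: filterS fg => x /= /(_ I) -> _.
Qed.

Lemma ae_eq_in_Lambda p f g : measurable_fun setT f -> measurable_fun setT g ->
  f = g %[ae mu] -> in_Lambda p f -> in_Lambda p g.
Proof.
move=> mf mg fg Lf delta delta0.
have [E [mE Edelta]] := Lf _ delta0.
rewrite !inE => /andP[/[!inE] mfE finfE]; exists E; split => //.
have mgE : measurable_fun setT (g \* \1_(~` E)).
  by apply: measurable_funM => //; apply: measurable_indic; exact: measurableC.
rewrite !inE; apply/andP; rewrite !inE; split => //=.
rewrite /= /finite_norm -(@ae_eq_Lnorm p (f \* \1_(~` E))) //.
by apply: filterS fg => x /= /(_ I) -> _.
Qed.

Lemma in_LambdaB p f g : 1 <= p ->
  measurable_fun setT f -> measurable_fun setT g ->
  in_Lambda p f -> in_Lambda p g -> in_Lambda p (f \- g).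
Proof.
move=> p1 mf mg Lf Lg delta delta0.
have delta20 : 0 < delta / 2 by rewrite divr_gt0.
have p0 : 0 < p by exact: lt_le_trans p1.
have [E [mE Edelta]] := Lf _ delta20.
rewrite !inE => /andP[/[!inE] mfE finfE].
have [F [mF Fdelta]] := Lg _ delta20.
rewrite !inE => /andP[/[!inE] mgF fingF].
exists (E `|` F); split; first exact: measurableU.
  rewrite (le_lt_trans (measureU2 _ _ _)) // (splitr delta) EFinD lteD //.
have mfgEF : measurable_fun setT ((f \- g) \* \1_(~` (E `|` F))).
  apply: measurable_funM; first exact: measurable_funB.
  by apply: measurable_indic; apply: measurableC; exact: measurableU.
rewrite inE; apply/andP; rewrite !inE; split => //=.
pose fE : T -> R := Num.norm \o (f \* \1_(~` E)); pose gF : T -> R := Num.norm \o (g \* \1_(~` F)).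
have mfE' : measurable_fun setT fE by exact: measurableT_comp.
have mgF' : measurable_fun setT gF by exact: measurableT_comp.
have NE h : ('N[mu]_p%:E[EFin \o (Num.norm \o h)] = 'N[mu]_p%:E[EFin \o h])%E.
  by rewrite -[RHS]Lnorm_abse.
rewrite /finite_norm.
have /le_lt_trans : ('N[mu]_p%:E[EFin \o ((f \- g) \* \1_(~` (E `|` F)))%R] <=
                     'N[mu]_p%:E[EFin \o (fE \+ gF)%R])%E.
  apply: le_Lnorm => //; first exact: measurable_funD.
  move=> x; rewrite /fE /gF /= !normrM [leRHS]ger0_norm ?addr_ge0 //.
  rewrite setCU indicI /= normrM.
  rewrite !indicE; do 2 case: (_ \in _) => /=;
    rewrite ?(normr0,normr1,mulr0,mulr1,mul0r,mul1r,addr0,add0r) //.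
  exact: ler_normB.
apply; rewrite (le_lt_trans (minkowski_EFin _ _ _ _)) // !NE.
exact: lte_add_pinfty.
Qed.

Lemma alpha_norm_lty p f : 1 <= p -> measurable_fun setT f ->
  in_Lambda p f -> (alpha_norm p f < +oo)%E.
Proof.
move=> p1 mf Lf; have p0 : 0 < p by exact: lt_le_trans p1.
have [E [mE E1]] := Lf _ (@ltr01 R).
rewrite !inE => /andP[/[!inE] mfE finfE].
pose fE : T -> R := Num.norm \o (f \* \1_(~` E)).
have mfE' : measurable_fun setT fE by exact: measurableT_comp.
have m1E : measurable_fun setT (\1_E : T -> R) by exact: measurable_indic.
have /le_lt_trans : (alpha_norm p f <= 'N[mu]_p%:E[EFin \o (fE \+ \1_E)%R])%E.
  apply: le_Lnorm => //; [exact: measurable_min1|exact: measurable_funD|].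
  move=> x; rewrite /fE /= normrM [leLHS]ger0_norm ?le_min ?normr_ge0 ?ler01 //.
  rewrite [leRHS]ger0_norm; last by rewrite addr_ge0 ?mulr_ge0 // indicE.
  rewrite !indicE in_setC; case: (_ \in _) => /=.
    by rewrite normr0 mulr0 add0r ge_min lexx orbT.
  by rewrite normr1 mulr1 addr0 ge_min lexx.
apply; rewrite (le_lt_trans (minkowski_EFin _ _ _ _)) // lte_add_pinfty //.
  by rewrite (_ : _ \o _ = abse \o (EFin \o (f \* \1_(~` E)))) // Lnorm_abse.
rewrite unlock poweR_lty //= (eq_integral (EFin \o (\1_E : T -> R))).
  by rewrite integral_indic // setIT (lt_trans E1) // ltry.
move=> x _ /=; rewrite indicE; case: (_ \in _) => /=.
  by rewrite normr1 powR1.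
by rewrite normr0 powR0 // gt_eqF.
Qed.

Lemma alpha_norm_triangle p f g h : 1 <= p ->
  measurable_fun setT f -> measurable_fun setT g -> measurable_fun setT h ->
  (alpha_norm p (f \- h)%R <=
   alpha_norm p (f \- g)%R + alpha_norm p (g \- h)%R)%E.
Proof.
move=> p1 mf mg mh; have p0 : 0 < p by exact: lt_le_trans p1.
have mfg := measurable_min1 (measurable_funB mf mg).
have mgh := measurable_min1 (measurable_funB mg mh).
have mfh := measurable_min1 (measurable_funB mf mh).
apply: le_trans (minkowski_EFin _ _ _ _) => //.
apply: le_Lnorm => //; first exact: measurable_funD.
move=> x /=; rewrite [leLHS]ger0_norm ?le_min ?normr_ge0 ?ler01 //.
rewrite [leRHS]ger0_norm ?addr_ge0 ?le_min ?normr_ge0 ?ler01 //.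
have := ler_distD (g x) (f x) (h x).
have := normr_ge0 (f x - g x); have := normr_ge0 (g x - h x).
move: `|f x - g x| `|g x - h x| `|f x - h x| => a b c b0 a0 cab.
by have [] := leP a 1; have [] := leP b 1; have [] := leP c 1; move=> *; lra.
Qed.

Lemma alpha_norm0_ae p f g : 1 <= p ->
  measurable_fun setT f -> measurable_fun setT g ->
  alpha_norm p (f \- g) = 0%E -> f = g %[ae mu].
Proof.
move=> p1 mf mg /Lnorm_eq0_eq0 h.
have {h} : EFin \o (fun x => Num.min `|(f \- g) x| 1) = \0 %[ae mu].
  apply: h; last by rewrite lte_fin; exact: lt_le_trans p1.
  by apply/measurable_EFinP/measurable_min1; exact: measurable_funB.
apply: filterS => x /= /(_ I) [] + _.
rewrite /Num.min; case: ltP => _ => [/normr0_eq0/subr0_eq//|/eqP].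
by rewrite oner_eq0.
Qed.

Section metric.
Variables (p : R) (p1 : 1 <= p).

Local Notation Lambda := (LambdaType p1).

Definition Lambda_fun (f : Lambda) : T -> R := val f.

Definition alpha_dist (f g : Lambda) : R :=
  fine (alpha_norm p (Lambda_fun f \- Lambda_fun g)).

HB.instance Definition _ := Choice.on Lambda.

Lemma measurable_Lambda_fun (f : Lambda) : measurable_fun setT (Lambda_fun f).
Proof. exact: (measurable_funPT (repr (val f))). Qed.

Lemma Lambda_funP (f : Lambda) : in_Lambda p (Lambda_fun f).
Proof. exact/asboolP/(valP f). Qed.

Lemma alpha_distE (f g : Lambda) :
  (alpha_dist f g)%:E = alpha_norm p (Lambda_fun f \- Lambda_fun g).
Proof.
rewrite /alpha_dist fineK // ge0_fin_numE ?Lnorm_ge0 //.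
have mf := @measurable_Lambda_fun f; have mg := @measurable_Lambda_fun g.
apply: alpha_norm_lty => //; first exact: measurable_funB.
by apply: in_LambdaB => //; exact: Lambda_funP.
Qed.

Let alpha_distxx (f : Lambda) : alpha_dist f f = 0.
Proof.
apply: EFin_inj; rewrite alpha_distE /alpha_norm.
rewrite (_ : _ \o _ = cst 0%E) ?Lnorm0 ?gt_eqF ?lte_fin ?(lt_le_trans ltr01) //.
by apply/funext => x /=; rewrite subrr normr0 min_l.
Qed.

Let alpha_dist_positivity (f g : Lambda) : alpha_dist f g = 0 -> f = g.
Proof.
move=> fg0; have : alpha_norm p (Lambda_fun f \- Lambda_fun g) = 0%E.
  by rewrite -alpha_distE fg0.
move=> /alpha_norm0_ae => /(_ p1 (measurable_Lambda_fun f)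
  (measurable_Lambda_fun g)) fg.
apply: val_inj; rewrite -[val f]reprK -[val g]reprK.
by apply/eqP; rewrite eqmodE; apply/asboolP.
Qed.

Let alpha_dist_sym (f g : Lambda) : alpha_dist f g = alpha_dist g f.
Proof.
rewrite /alpha_dist /alpha_norm; congr (fine (Lnorm _ _ _)).
by apply/funext => x /=; rewrite distrC.
Qed.

Let alpha_dist_triangle (g f h : Lambda) :
  alpha_dist f h <= alpha_dist f g + alpha_dist g h.
Proof.
rewrite -lee_fin EFinD !alpha_distE.
by apply: alpha_norm_triangle => //; exact: measurable_Lambda_fun.
Qed.

HB.instance Definition _ := isMetric.Build R Lambda
  alpha_distxx alpha_dist_positivity alpha_dist_sym alpha_dist_triangle.

End metric.
End Lambda.

Definition separable (X : topologicalType) : Prop :=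
  exists2 D : set X, countable D & dense D.

(* Main.v *)
(* A function f with finite alpha_p-norm is a pointwise limit of simple functions
   f_n, each vanishing off a box, with |f - f_n| <= |f|; by dominated convergence
   f_n -> f in the metric.  Also by dominated convergence, the sets A such that
   every c 1_(A n Q), Q a box, is a limit of rational combinations of indicators
   of rational boxes form a lambda-system.  It contains the rational boxes, which
   are a pi-system, hence all measurable sets. *)
Require Import Defs.
From mathcomp Require Import all_boot all_order all_algebra.
From mathcomp Require Import all_classical all_reals all_analysis.
From mathcomp Require Import measurable_realfun lra.
Set Implicit Arguments.
Unset Strict Implicit.
Unset Printing Implicit Defensive.
Import Order.TTheory GRing.Theory Num.Theory.
Import numFieldNormedType.Exports HBNNSimple.
Local Open Scope classical_set_scope.
Local Open Scope ring_scope.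

(* The u i x play the role of distances to points i outside X, so that the
   approximating family need not be shown to lie in X. *)
Lemma separable_countable_approx (R : realType) (X : metricType R)
    (I : countType) (u : I -> X -> \bar R) :
  (forall i x y, ((mdist x y)%:E <= u i x + u i y)%E) ->
  (forall x (e : R), 0 < e -> exists i, (u i x < e%:E)%E) -> separable X.
Proof.
move=> duu uP.
(* For each index and each precision 1/(n+1), a point of X within that precision is picked if there
   is one. [None] covers the other case, in which X may even be empty. *)
have pickP (k : I * nat) : exists w : option X,
    forall x, (u k.1 x < k.2.+1%:R^-1%:E)%E ->
    exists2 y, w = Some y & (u k.1 y < k.2.+1%:R^-1%:E)%E.
  have [[y uy]|nuy] := pselect (exists y, (u k.1 y < k.2.+1%:R^-1%:E)%E).
    by exists (Some y) => x _; exists y.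
  by exists None => x ux; exfalso; apply: nuy; exists x.
have [w wP] := choice pickP.
exists (\bigcup_k [set y | w k = Some y]).
  apply: bigcup_countable => // k _; case: (w k) => [y|].
    apply: (@sub_countable _ _ _ [set y]) => //.
    by apply: subset_card_le => z [->].
  apply: (@sub_countable _ _ _ set0) => //.
  by apply: subset_card_le.
move=> O [x Ox] oO.
have /nbhs_ballP[e /= e0 eO] : nbhs x O by exact: open_nbhs_nbhs.
(* Both x and the picked point y are within e/2 of the same index i, so [duu] puts y in the ball of
   radius e around x. *)
have e20 : 0 < e / 2 by rewrite divr_gt0.
have [n _ /(_ n (leqnn _)) /= ne] := near_infty_natSinv_lt (PosNum e20).
have n0 : (0 : R) < n.+1%:R^-1 by rewrite invr_gt0.
have [i uix] := uP x _ n0.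
have [y wy uiy] := wP (i, n) _ uix.
exists y; split; last by exists (i, n).
apply: eO; rewrite ballEmdist /= -lte_fin; apply: (le_lt_trans (duu i x y)).
by rewrite (splitr e) EFinD lteD // ?(lt_trans uix) ?(lt_trans uiy) ?lte_fin.
Qed.

(** * Finiteness and dominated convergence for the truncated norm *)

Section alpha_norm.
Context {d} {T : measurableType d} {R : realType}.
Variables (mu : {measure set T -> \bar R}) (p : R).
Hypothesis p1 : 1 <= p.
Implicit Types f g : T -> R.

Let p0 : 0 < p. Proof. exact: lt_le_trans p1. Qed.

Lemma measurable_min1_powR f : measurable_fun setT f ->
  measurable_fun setT (fun x => ((Num.min `|f x| 1) `^ p)%:E).
Proof.
move=> mf; apply/measurable_EFinP.
apply: (@measurableT_comp _ _ _ _ _ _ (@powR R ^~ p)) => //.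
exact: measurable_min1.
Qed.

Lemma alpha_normE f : (alpha_norm mu p f =
  (\int[mu]_x ((Num.min `|f x| 1) `^ p)%:E) `^ p^-1)%E.
Proof.
rewrite /alpha_norm unlock /=; congr (_ `^ _)%E; apply: eq_integral => x _ /=.
by rewrite ger0_norm // le_min normr_ge0 ler01.
Qed.

Lemma alpha_norm_cst0 : alpha_norm mu p (cst 0) = 0%E.
Proof.
rewrite alpha_normE integral0_eq ?poweR0r ?invr_eq0 ?gt_eqF // => x _ /=.
by rewrite normr0 min_l // powR0 // gt_eqF.
Qed.

(** Truncation at 1 makes the bound independent of c: min(|c 1_A|, 1)^p is at most 1_A. *)
Lemma alpha_norm_indic_lty (c : R) A : measurable A -> (mu A < +oo)%E ->
  (alpha_norm mu p (fun x => c * \1_A x)%R < +oo)%E.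
Proof.
move=> mA muA; rewrite alpha_normE poweR_lty //.
apply: (@le_lt_trans _ _ (\int[mu]_x (\1_A x : R)%:E)%E); last first.
  by rewrite integral_indic // setIT.
apply: ge0_le_integral => //=.
- exact/measurable_min1_powR/measurable_funM.
- by apply/measurable_EFinP.
- move=> x _; rewrite lee_fin indicE; case: (_ \in _) => /=.
    apply: (@le_trans _ _ (1 `^ p)); last by rewrite powR1.
    rewrite ge0_ler_powR ?nnegrE ?(ltW p0) //.
  by rewrite mulr0 normr0 min_l // powR0 // gt_eqF.
Qed.

(** Dominated convergence is applied to min(|f_n|, 1)^p, with dominating function min(|g|, 1)^p. The
    latter is integrable because the norm of g is finite. *)
Lemma alpha_norm_dominated_cvg g (f_ : nat -> T -> R) :
  (forall n, measurable_fun setT (f_ n)) ->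
  measurable_fun setT g -> (alpha_norm mu p g < +oo)%E ->
  (forall n x, `|f_ n x| <= `|g x|) ->
  (forall x, f_ n x @[n --> \oo] --> 0) ->
  forall e, 0 < e -> exists n, (alpha_norm mu p (f_ n) < e%:E)%E.
Proof.
move=> mf mg goo fg f0 e e0.
pose m f x := (Num.min `|f x| 1) `^ p.
have m_ge0 f' x : 0 <= m f' x by exact: powR_ge0.
have mm h : measurable_fun setT h -> measurable_fun setT (EFin \o m h).
  exact: measurable_min1_powR.
have : (\int[mu]_x (m (f_ n) x)%:E)%E @[n --> \oo] --> (\int[mu]_x (cst 0 x))%E.
  apply: (@dominated_cvg _ _ _ _ _ _ _ _ (EFin \o m g)) => //=.
  - by move=> n; exact: mm.
  - move=> x _; apply: cvg_EFin; first exact: nearW.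
    apply: (@squeeze_cvgr _ _ _ _ (cst 0) (Num.norm \o f_^~ x)).
    + apply: nearW => n; rewrite m_ge0 /= /m.
      (* For 0 < a <= 1 and p >= 1, a^p <= a bounds the power by |f_n x|. The value 0 is set apart
         because [ge1r_powR] asks for a > 0. *)
      have [->|fx0] := eqVneq (f_ n x) 0.
        by rewrite normr0 min_l // powR0 // gt_eqF.
      apply: (@le_trans _ _ (Num.min `|f_ n x| 1)); last by rewrite ge_min lexx.
      apply: ge1r_powR => //.
      by rewrite lt_min normr_gt0 fx0 ltr01 ge_min lexx orbT.
    + exact: cvg_cst.
    + by rewrite -(normr0 R); apply: cvg_norm.
  - apply/integrableP; split; first exact: mm.
    move: goo; rewrite alpha_normE => /lty_poweRy.
    rewrite invr_eq0 gt_eqF // => /(_ isT); apply: le_lt_trans.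
    rewrite le_eqVlt; apply/orP; left; apply/eqP/eq_integral => x _ /=.
    by rewrite ger0_norm.
  - move=> n x _; rewrite lee_fin ger0_norm // ge0_ler_powR ?nnegrE ?(ltW p0) //.
    + by rewrite le_min !ge_min fg lexx orbT.
rewrite integral0 => I0.
(* The p-th root of this threshold is e/2. Roots are compared with [<=], and the halving restores
   the strict inequality. *)
have ep0 : 0 < (e / 2) `^ p by rewrite powR_gt0 // divr_gt0.
have [n _ /(_ n (leqnn _)) /= In] :=
  I0 _ (@nbhs_open_ereal_lt _ 0 (fun=> (e / 2) `^ p) ep0).
exists n; apply: (@le_lt_trans _ _ (e / 2)%:E); last first.
  by rewrite lte_fin; lra.
have -> : e / 2 = ((e / 2) `^ p) `^ p^-1.
  by rewrite -powRrM divff ?gt_eqF // powRr1 // ltW // divr_gt0.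
rewrite -poweR_EFin alpha_normE gt0_ler_poweR ?invr_ge0 ?(ltW p0) //.
- by rewrite in_itv /= leey andbT integral_ge0.
- by rewrite in_itv /= leey andbT lee_fin ltW.
- exact: ltW.
Qed.

End alpha_norm.

(** * Approximation by rational combinations of indicators of generators *)

Section approximation.
Context {d} {T : measurableType d} {R : realType}.
Variables (mu : {measure set T -> \bar R}) (p : R).
Hypothesis p1 : 1 <= p.
Variables (I : countType) (B : I -> set T).
Hypotheses (mB : forall i, measurable (B i))
  (Boo : forall i, (mu (B i) < +oo)%E)
  (BI : setI_closed (range B)) (BE : @measurable _ T = <<s range B >>).
Implicit Types f g : T -> R.

(** Encoding the combinations by finite sequences makes them a family indexed by a countable
    type. *)
Definition rat_comb (s : seq (rat * I)) (x : T) : R :=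
  \sum_(k <- s) ratr k.1 * \1_(B k.2) x.

(** Measurability is carried along because [alpha_norm_triangle] asks for it. *)
Definition approximable f := measurable_fun setT f /\
  forall e : R, 0 < e ->
  exists s, (alpha_norm mu p (f \- rat_comb s)%R < e%:E)%E.

Lemma measurable_rat_comb s : measurable_fun setT (rat_comb s).
Proof.
by apply: measurable_sum => k; apply: measurable_funM.
Qed.

Lemma rat_comb_cat s t : rat_comb (s ++ t) = rat_comb s \+ rat_comb t.
Proof. by apply/funext => x; rewrite /rat_comb big_cat. Qed.

Lemma rat_combN s : rat_comb [seq (- k.1, k.2) | k <- s] = \- rat_comb s.
Proof.
apply/funext => x; rewrite /rat_comb big_map /= -sumrN.
by apply: eq_bigr => k _; rewrite rmorphN mulNr.
Qed.

Lemma approximable_rat_comb s : approximable (rat_comb s).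
Proof.
split=> [|e e0]; first exact: measurable_rat_comb.
exists s; rewrite (_ : _ \- _ = cst 0); first by rewrite alpha_norm_cst0.
by apply/funext => x /=; rewrite subrr.
Qed.

Lemma approximableD f g : approximable f -> approximable g ->
  approximable (f \+ g).
Proof.
move=> [mf fP] [mg gP]; split=> [|e e0]; first exact: measurable_funD.
have e20 : 0 < e / 2 by rewrite divr_gt0.
have [s fs] := fP _ e20; have [t gt] := gP _ e20; exists (s ++ t).
have ms := measurable_rat_comb s; have mt := measurable_rat_comb t.
rewrite rat_comb_cat.
(* The intermediate function replaces f first and g afterwards, so each error is that of one
   summand. *)
apply: (@le_lt_trans _ _ (alpha_norm mu p ((f \+ g) \- (rat_comb s \+ g))%R +
    alpha_norm mu p ((rat_comb s \+ g) \- (rat_comb s \+ rat_comb t))%R)%E).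
  by apply: alpha_norm_triangle => //; exact: measurable_funD.
rewrite (splitr e) EFinD lteD //.
- rewrite (_ : _ \- _ = f \- rat_comb s) //.
  by apply/funext => x /=; lra.
- rewrite (_ : _ \- _ = g \- rat_comb t) //.
  by apply/funext => x /=; lra.
Qed.

Lemma approximableN f : approximable f -> approximable (\- f).
Proof.
move=> [mf fP]; split=> [|e e0]; first exact: measurable_funN.
have [s fs] := fP _ e0; exists [seq (- k.1, k.2) | k <- s].
rewrite rat_combN (_ : alpha_norm _ _ _ = alpha_norm mu p (f \- rat_comb s)) //.
congr (Lnorm _ _ _); apply/funext => x /=.
by rewrite -opprD normrN.
Qed.

Lemma approximable_sum (J : Type) (r : seq J) (f : J -> T -> R) :
  (forall j, approximable (f j)) ->
  approximable (fun x => \sum_(j <- r) f j x).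
Proof.
move=> fP; elim: r => [|j r IH].
  rewrite (_ : (fun _ => _) = rat_comb [::]); first exact: approximable_rat_comb.
  by apply/funext => x; rewrite /rat_comb !big_nil.
rewrite (_ : (fun _ => _) = f j \+ (fun x => \sum_(j <- r) f j x)).
  exact: approximableD.
by apply/funext => x; rewrite big_cons.
Qed.

(** Dominated convergence of the errors f - f_n yields some f_n within e/2 of f, and a rational
    combination lies within e/2 of that f_n. *)
Lemma approximable_dominated f g (f_ : nat -> T -> R) :
  measurable_fun setT f -> (forall n, approximable (f_ n)) ->
  measurable_fun setT g -> (alpha_norm mu p g < +oo)%E ->
  (forall n x, `|f x - f_ n x| <= `|g x|) ->
  (forall x, f_ n x @[n --> \oo] --> f x) -> approximable f.
Proof.
move=> mf f_P mg goo fg f_f; split=> // e e0.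
have e20 : 0 < e / 2 by rewrite divr_gt0.
have [n fn] : exists n, (alpha_norm mu p (f \- f_ n)%R < (e / 2)%:E)%E.
  have mff n : measurable_fun setT (f \- f_ n).
    by apply: measurable_funB => //; exact: (f_P n).1.
  apply: (alpha_norm_dominated_cvg p1 mff mg goo fg _ e20) => x.
  by rewrite -(subrr (f x)); apply: cvgB => //; exact: cvg_cst.
have [s fs] := (f_P n).2 _ e20; exists s.
apply: (@le_lt_trans _ _ (alpha_norm mu p (f \- f_ n)%R +
    alpha_norm mu p (f_ n \- rat_comb s)%R)%E).
  apply: alpha_norm_triangle => //; last exact: measurable_rat_comb.
  exact: (f_P n).1.
by rewrite (splitr e) EFinD lteD.
Qed.

(** Rationals q_n with |c - q_n| <= 1/(n+1) <= 1 tend to c, and the errors are dominated by the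
    indicator of [B i]. *)
Lemma approximable_generator (c : R) i : approximable (fun x => c * \1_(B i) x).
Proof.
have qP n : exists q : rat, `|c - ratr q| <= n.+1%:R^-1.
  have : c < c + n.+1%:R^-1 by rewrite ltrDl invr_gt0.
  move=> /rat_in_itvoo [q]; rewrite in_itv /= => /andP[cq qc]; exists q.
  by rewrite ler0_norm ?subr_le0 ?(ltW cq) // opprB lerBlDl ltW.
have [q qc] := choice qP.
apply: (@approximable_dominated _ (fun x => 1 * \1_(B i) x)
  (fun n x => ratr (q n) * \1_(B i) x)).
- by apply: measurable_funM => //; exact: measurable_indic.
- move=> n; rewrite (_ : (fun _ => _) = rat_comb [:: (q n, i)]).
    exact: approximable_rat_comb.
  by apply/funext => x; rewrite /rat_comb big_seq1.
- by apply: measurable_funM => //; exact: measurable_indic.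
- exact: alpha_norm_indic_lty.
- move=> n x; rewrite -mulrBl !normrM ler_wpM2r // normr1.
  by rewrite (le_trans (qc n)) // invf_le1 // ler1n.
- move=> x; apply: cvgMl => /=; apply/cvgrPdist_lt => e e0.
  have := near_infty_natSinv_lt (PosNum e0); apply: filterS => n.
  exact/le_lt_trans/qc.
Qed.

(** Since A may have infinite measure, it is cut down to [B i]: all errors in the Dynkin argument
    are then dominated by a multiple of the indicator of [B i], whose norm is finite. *)
Lemma approximable_indic (c : R) i A : measurable A ->
  approximable (fun x => c * \1_(A `&` B i) x).
Proof.
move=> mA.
have mI (a : R) (C : set T) : measurable C ->
    measurable_fun setT (fun x => a * \1_C x).
  by move=> mC; apply: measurable_funM => //; exact: measurable_indic.
suff [] : [set A | measurable A /\ forall c : R,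
    approximable (fun x => c * \1_(A `&` B i) x)] A by [].
move: A mA; rewrite [X in forall A, X A -> _]BE.
apply: lambda_system_subset => //; last first.
  move=> _ [j _ <-]; split => // a.
  have [k _ <-] : range B (B j `&` B i) by apply: BI; [exists j|exists i].
  exact: approximable_generator.
split => //.
- split=> // a; rewrite setTI; exact: approximable_generator.
(* As D is included in C, the indicator of the difference is the difference of the indicators. *)
- move=> C D DC [mC CP] [mD DP]; split=> [|a]; first exact: measurableD.
  rewrite (_ : (fun _ => _) = (fun x => a * \1_(C `&` B i) x) \+
      (\- (fun x => a * \1_(D `&` B i) x))).
    by apply: approximableD => //; exact: approximableN.
  apply/funext => x /=; rewrite -mulrBr !indicE; congr (_ * _).
  rewrite in_setI in_setD !in_setI; case: (boolP (x \in D)) => xD; last first.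
    by rewrite /= andbT subr0.
  have -> : x \in C by apply/mem_set/DC/set_mem.
  by rewrite andbF /= subrr.
move=> F ndF FP.
have mUF : measurable (\bigcup_k F k).
  by apply: bigcup_measurable => k _; exact: (FP k).1.
split=> // a; apply: (@approximable_dominated _ (fun x => a * \1_(B i) x)
  (fun n x => a * \1_(F n `&` B i) x)).
- by apply: mI; exact: measurableI.
- by move=> n; exact: (FP n).2.
- exact: mI.
- exact: alpha_norm_indic_lty.
- move=> n x; rewrite -mulrBr !normrM ler_wpM2l // !indicE !in_setI.
  case: (x \in B i); last by rewrite !andbF subrr.
  rewrite !andbT; case: (x \in F n); case: (_ \in _) => /=;
  by rewrite ?(subrr,subr0,sub0r) ?normrN ?normr0 ?normr1 ?ler01.
(* The sequence is eventually constant: from an index k with x in [F k] on, or throughout if x is in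
   no [F n]. *)
- move=> x; apply: cvgMr; apply: cvg_near_cst.
  have [[k _ Fkx]|nFx] := pselect ((\bigcup_k F k) x).
    exists k => // n /= kn; rewrite !indicE !in_setI; congr ((_ && _)%:R).
    rewrite !mem_set //; first by exists k.
    by move: x Fkx; exact/subsetPset/ndF.
  apply: nearW => n; rewrite !indicE !in_setI; congr ((_ && _)%:R).
  by rewrite !memNset // => Fnx; apply: nFx; exists n.
Qed.

(** An exhaustion of the space by generators; it serves to truncate functions to sets of finite
    measure. *)
Variable (b : nat -> I).
Hypotheses (ndb : {homo (B \o b) : m n / (m <= n)%N >-> m `<=` n})
  (bT : \bigcup_n B (b n) = setT).

(** On each of its finitely many level sets h is constant, which reduces the claim to
    [approximable_indic]. *)
Lemma approximable_nnsfun (h : {nnsfun T >-> R}) i :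
  approximable (fun x => h x * \1_(B i) x).
Proof.
rewrite (_ : (fun _ => _) = fun x =>
  \sum_(y <- finmap.enum_fset (fset_set (range h)))
    y * \1_((h @^-1` [set y]) `&` B i) x).
  by apply: approximable_sum => y; exact: approximable_indic.
apply/funext => x; rewrite {1}(fimfunE h) fsbig_finite // mulr_suml.
by apply: eq_bigr => y _; rewrite indicI mulrA.
Qed.

Lemma approximable_alpha_norm_lty f : measurable_fun setT f ->
  (alpha_norm mu p f < +oo)%E -> approximable f.
Proof.
move=> mf foo.
have mfp : measurable_fun setT (EFin \o f^\+).
  exact/measurable_EFinP/measurable_funrpos.
have mfn : measurable_fun setT (EFin \o f^\-).
  exact/measurable_EFinP/measurable_funrneg.
have fE x : f x = f^\+ x - f^\- x.
  exact: (congr1 (@^~ x) (esym (funrposBneg f))).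
have nfE x : `|f x| = f^\+ x + f^\- x.
  exact: (congr1 (@^~ x) (esym (funrposDneg f))).
pose u n := nnsfun_approx measurableT mfp n.
pose v n := nnsfun_approx measurableT mfn n.
have fp0 (x : T) : setT x -> (0 <= (EFin \o f^\+)%R x)%E.
  by rewrite lee_fin funrpos_ge0.
have fn0 (x : T) : setT x -> (0 <= (EFin \o f^\-)%R x)%E.
  by rewrite lee_fin funrneg_ge0.
have uf x : u n x @[n --> \oo] --> f^\+ x.
  under eq_fun do rewrite nnsfun_approxE.
  by apply: (cvg_approx fp0) => //; exact: ltry.
have vf x : v n x @[n --> \oo] --> f^\- x.
  under eq_fun do rewrite nnsfun_approxE.
  by apply: (cvg_approx fn0) => //; exact: ltry.
have ule n x : 0 <= u n x <= f^\+ x.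
  by rewrite fun_ge0 nnsfun_approxE -lee_fin (le_approx _ fp0).
have vle n x : 0 <= v n x <= f^\- x.
  by rewrite fun_ge0 nnsfun_approxE -lee_fin (le_approx _ fn0).
apply: (@approximable_dominated _ f (fun n x =>
  u n x * \1_(B (b n)) x - v n x * \1_(B (b n)) x)) => //.
- move=> n; apply: (@approximableD (fun x => _ * _) (\- (fun x => _ * _))).
    exact: approximable_nnsfun.
  by apply: approximableN; exact: approximable_nnsfun.
(* Off the set [B (b n)] the error is |f|. On it, 0 <= u <= f^+ and 0 <= v <= f^- bound |(f^+ - u) -
   (f^- - v)| by f^+ + f^- = |f|. *)
- move=> n x; rewrite indicE.
  case: (_ \in _); last by rewrite !mulr0 subr0 subr0.
  rewrite !mulr1 nfE fE.
  have := ule n x; have := vle n x; move: (u n x) (v n x) (f^\+ x) (f^\- x).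
  move=> r s r' s' /andP[? ?] /andP[? ?]; rewrite ler_norml.
  by apply/andP; split; lra.
- move=> x; have [k _ Bkx] : (\bigcup_n B (b n)) x by rewrite bT.
  have I1 : \1_(B (b n)) x @[n --> \oo] --> (1 : R).
    apply: cvg_near_cst; exists k => // n /= kn.
    by rewrite indicE mem_set //; exact: ndb Bkx.
  rewrite fE -[f^\+ x]mulr1 -[f^\- x]mulr1.
  by apply: cvgB; apply: cvgM.
Qed.

(** The functions [rat_comb s] are the outside points of [separable_countable_approx]; their
    distance to a class is measured on its representative. *)
Lemma separable_Lambda : separable (LambdaType mu p1).
Proof.
apply: (@separable_countable_approx _ _ _
  (fun s (L : LambdaType mu p1) =>
     alpha_norm mu p (Lambda_fun L \- rat_comb s)%R)).
  move=> s L M; rewrite [mdist _ _]/(alpha_dist L M) alpha_distE.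
  have mL := @measurable_Lambda_fun _ _ _ _ _ p1 L.
  have mM := @measurable_Lambda_fun _ _ _ _ _ p1 M.
  have ms := measurable_rat_comb s.
  rewrite (_ : alpha_norm mu p (Lambda_fun M \- _)%R =
    alpha_norm mu p (rat_comb s \- Lambda_fun M)%R); last first.
    by congr (Lnorm _ _ _); apply/funext => x /=; rewrite distrC.
  exact: alpha_norm_triangle.
move=> L e e0.
have mL := @measurable_Lambda_fun _ _ _ _ _ p1 L.
apply: (approximable_alpha_norm_lty mL _).2 => //.
by apply: alpha_norm_lty => //; exact: Lambda_funP.
Qed.

End approximation.

(** * Open boxes with rational endpoints as a generating pi-system *)

Section boxes.
Context {R : realType} {d : nat}.

(** Endpoints may come in the wrong order and give an empty box, so disjoint boxes still intersect
    in a box. *)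
Definition box (q : d.-tuple (rat * rat)) : set (euclid R d) :=
  [set t | forall i, [set` `]ratr (tnth q i).1, ratr (tnth q i).2[] (tnth t i)].

Lemma measurable_box q : measurable (box q).
Proof.
rewrite (_ : box q = \bigcap_(i in [set: 'I_d])
    ((fun t : euclid R d => tnth t i) @^-1`
     [set` `]ratr (tnth q i).1, ratr (tnth q i).2[])).
  apply: fin_bigcap_measurable; first exact: finite_finset.
  move=> i _; rewrite -[X in measurable X]setTI; apply: measurable_tnth => //.
by apply/seteqP; split => t /= h i; [move=> _|]; exact: h.
Qed.

Lemma lebesgue_box_lty q : (lebesgue_tuple R d (box q) < +oo)%E.
Proof.
rewrite (lebesgue_tuple_box (A := fun i =>
  [set` `]ratr (tnth q i).1, ratr (tnth q i).2[])); last first.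
  by move=> i; exact: measurable_itv.
rewrite ltey_eq prode_fin_num // => i _.
by rewrite lebesgue_measure_itv; case: ifP.
Qed.

Lemma setI_closed_box : setI_closed (range box).
Proof.
move=> _ _ [q _ <-] [r _ <-].
exists [tuple (Num.max (tnth q i).1 (tnth r i).1,
               Num.min (tnth q i).2 (tnth r i).2) | i < d] => //.
have ratr_max (a b : rat) : ratr (Num.max a b) = Num.max (ratr a) (ratr b) :> R.
  by rewrite !maxEle ler_rat; case: ifP.
have ratr_min (a b : rat) : ratr (Num.min a b) = Num.min (ratr a) (ratr b) :> R.
  by rewrite !minEle ler_rat; case: ifP.
apply/seteqP; split=> t /=.
  move=> h; split=> i; have := h i;
    rewrite tnth_mktuple /= !in_itv /= ratr_max ratr_min.
    by rewrite gt_max lt_min => /andP[/andP[-> _] /andP[-> _]].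
  by rewrite gt_max lt_min => /andP[/andP[_ ->] /andP[_ ->]].
move=> [hq hr] i; have := hq i; have := hr i.
rewrite tnth_mktuple /= !in_itv /= ratr_max ratr_min gt_max lt_min.
by move=> /andP[-> ->] /andP[-> ->].
Qed.

(** The sets C whose preimage under a coordinate lies in the generated sigma-algebra form a
    sigma-algebra, so open rays suffice. The preimage of a ray is the union of the countably many
    rational boxes that it contains. *)
Lemma measurable_euclidE : @measurable _ (euclid R d) = <<s range box >>.
Proof.
apply/seteqP; split; last first.
  apply: smallest_sub; first exact: sigma_algebra_measurable.
  by move=> _ [q _ <-]; exact: measurable_box.
apply: smallest_sub; first exact: smallest_sigma_algebra.
move=> A; rewrite -bigcup_seq /= => -[i _ [C mC <-]].
rewrite setTI; move: C mC; rewrite (RGenOInfty.measurableE R).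
set G := <<s range box >>.
suff : <<s @RGenOInfty.G R >> `<=`
    [set C | G ((fun t : euclid R d => tnth t i) @^-1` C)] by exact.
apply: smallest_sub.
  split => [|C GC|F GF] /=.
  - by rewrite preimage_set0; exact: sigma_algebra0.
  - by rewrite setTD; exact: sigma_algebraC.
  - by rewrite preimage_bigcup; exact: sigma_algebra_bigcup.
move=> _ [x ->] /=.
set P := _ @^-1` _.
rewrite (_ : P = \bigcup_(q in [set q | box q `<=` P]) box q).
  rewrite bigcup_mkcond.
  apply: (@countable_bigcupT_measurable _ (g_sigma_algebraType _)) => //.
  move=> q; case: ifP => // _; by apply: sub_sigma_algebra; exists q.
apply/seteqP; split=> [t Pt|t [q /= qP]]; last exact: qP.
have qP j : exists ab : rat * rat,
    ratr ab.1 < tnth t j < ratr ab.2 /\ (j = i -> x < ratr ab.1).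
  (* In coordinate i the left endpoint has to stay above x; in the others any bound below [tnth t j]
     will do. *)
  have : (if j == i then x else tnth t j - 1) < tnth t j.
    case: eqP => [->|_]; last by rewrite ltrBlDr ltrDl.
    by move: Pt; rewrite /P /= in_itv /= andbT.
  move=> /rat_in_itvoo [r1]; rewrite in_itv /= => /andP[xr1 r1t].
  have /rat_in_itvoo [r2] : tnth t j < tnth t j + 1 by rewrite ltrDl.
  rewrite in_itv /= => /andP[tr2 _]; exists (r1, r2).
  rewrite r1t tr2; split=> // ji.
  by move: xr1; rewrite ji eqxx.
have [q hq] := choice qP.
exists [tuple q j | j < d] => [s /(_ i)|j] /=; rewrite tnth_mktuple !in_itv /=.
  move=> /andP[qs _]; rewrite /P /= in_itv /= andbT.
  exact: lt_trans ((hq i).2 erefl) qs.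
exact: (hq j).1.
Qed.

End boxes.

Theorem proposition6p4 (R : realType) (d : nat) (d_gt0 : (0 < d)%N)
    (p : R) (p1 : 1 <= p) :
  separable (LambdaType (lebesgue_tuple R d) p1).
Proof.
(* The exhausting sets are the open cubes of half-side n centred at the origin. *)
pose b n : d.-tuple (rat * rat) := [tuple (- n%:R, n%:R) | i < d].
have bE n (t : euclid R d) : box (b n) t <-> forall i, `|tnth t i| < n%:R.
  by split=> h i; have := h i;
    rewrite ltr_norml tnth_mktuple /= in_itv /= rmorphN /= !ratr_nat.
apply: (@separable_Lambda _ _ _ _ _ p1 _ box measurable_box lebesgue_box_lty
  setI_closed_box measurable_euclidE b).
  move=> m n mn t /bE tm; apply/bE => i.
  by rewrite (lt_le_trans (tm i)) // ler_nat.
apply/seteqP; split=> // t _.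
(* The sum bounds all coordinates at once, so a single n serves for every i. *)
have [n tn] : exists n : nat, \sum_i `|tnth t i| < n%:R.
  exists (Num.bound (\sum_i `|tnth t i|)).
  by rewrite archi_boundP // sumr_ge0.
exists n => //; apply/bE => i; apply: le_lt_trans tn.
by rewrite (bigD1 i) //= lerDl sumr_ge0.
Qed.
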